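(* Suppose $\lceil N/M\rceil\ge e$ and the target gain $g$ satisfies $7\le g\le \frac{(N/M)^2}{3\log(N/M)}$, and let $K$ be a large multiple of $K'=\lceil N/M\rceil\,3g\log(N/M)$. Partition the $K$ users into groups of $K'$ users each; use the new placement scheme for all users, and apply the modified (pull-down) delivery scheme with parameter $g$ separately within each group (transmissions for a group use only the demands and caches of that group's users), with $F=O\big(\binom{K'}{g}(\log\binom{K'}{g})^2\lceil N/M\rceil\big)\approx O\big((N/M)^{g+1}(3e)^g(\log(N/M))^{g+2}g^2\big)$ packets per file. Then for every demand pattern, the expected total normalized number of transmissions required for all users is at most $\frac43\frac{K}{g+1}(1+o(1))$, the expectation being over the randomness of placement and delivery.
   Context: Setting: a server holds a library of $N$ files ($N>K'$), each split into $F$ packets (packet $f$ of file $n$ denoted $(n,f)$); $K$ users each have a cache of size $M$ files ($M\le N$). For a cache configuration, $S_{n,f}$ is the set of users whose cache stores packet $(n,f)$. User $k$ requests file $d_k$. New placement scheme: $F=\lceil N/M\rceil F'$ with $F'$ a positive integer; the packets of each file are partitioned into $F'$ groups of $\lceil N/M\rceil$ packets. For every user, file and group, exactly one packet of the group is chosen uniformly at random and stored in the user's cache; all choices are independent. Modified delivery scheme with parameter $g$ applied to a set $U$ of users: (1) Pull-down phase: for every $k\in U$ and packet $f$ with $|S_{d_k,f}\cap U|\ge g+1$, replace (virtually) the storing set by a uniformly random $g$-element subset of it, independently. (2) With these sets (restricted to $U$), for $k\in U$ and $T\subseteq U\setminus\{k\}$ let $V_{k,T}$ be the set of packets of file $d_k$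 whose storing set equals $T$; for every nonempty $\mathcal{S}\subseteq U$ transmit the XOR of the zero-padded vectors $V_{k,\mathcal{S}\setminus\{k\}}$, $k\in\mathcal{S}$. The normalized number of transmissions for $U$ is $\sum_{\emptyset\ne\mathcal{S}\subseteq U}\max_{k\in\mathcal{S}}|V_{k,\mathcal{S}\setminus\{k\}}|/F$; the total is the sum over the groups. The $o(1)$ term tends to $0$ as the group size $K'$ grows. *)

(* Defs.v *)
From HB Require Import structures.
From mathcomp Require Import all_boot all_order all_algebra.
From mathcomp Require Import all_classical all_reals.
From mathcomp Require Import all_analysis.
Set Implicit Arguments. Unset Strict Implicit. Unset Printing Implicit Defensive.
Import Order.TTheory GRing.Theory Num.Theory.
Local Open Scope ring_scope.

Definition ceil_nat {R : realType} (x : R) : nat := `|Num.ceil x|%N.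

(* Users 'I_K, files 'I_N. Each file has F = q * F' packets, indexed as
   (group j : 'I_F', position i : 'I_q), q = ceil(N/M).
   A placement chooses, for every (user, file, group), the one packet of the
   group stored by that user. *)
Definition placement (K N F' q : nat) := {ffun 'I_K * 'I_N * 'I_F' -> 'I_q}.
Definition packet (F' q : nat) := ('I_F' * 'I_q)%type.

Definition storing_set K N F' q (pl : placement K N F' q) (n : 'I_N)
  (p : packet F' q) : {set 'I_K} :=
  [set k | pl (k, n, p.1) == p.2].

Definition user_group (K Kp : nat) (k : 'I_K) : {set 'I_K} :=
  [set k' : 'I_K | k' %/ Kp == k %/ Kp]%N.

Definition user_groups (K Kp : nat) : {set {set 'I_K}} :=
  [set user_group Kp k | k : 'I_K].

(* A pull-down outcome: for each user k and packet f of file d_k, the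
   (virtual) storing set used for k, restricted to k's group U. *)
Definition pulldown K F' q := {ffun 'I_K * packet F' q -> {set 'I_K}}.

(* c is a possible outcome of the pull-down phase with parameter g:
   if |S_{d_k,f} ∩ U| >= g+1 then c(k,f) is a g-subset of it,
   otherwise c(k,f) = S_{d_k,f} ∩ U. The uniform distribution on the set of
   valid outcomes is exactly the product of independent uniform choices. *)
Definition pulldown_valid K N F' q (g Kp : nat) (d : {ffun 'I_K -> 'I_N})
  (pl : placement K N F' q) (c : pulldown K F' q) : bool :=
  [forall k : 'I_K, forall p : packet F' q,
    let S' := storing_set pl (d k) p :&: user_group Kp k in
    if (g < #|S'|)%N then (c (k, p) \subset S') && (#|c (k, p)| == g)
    else c (k, p) == S'].

Definition Vsize K F' q (c : pulldown K F' q) (k : 'I_K) (T : {set 'I_K}) : nat :=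
  #|[set p : packet F' q | c (k, p) == T]|.

Definition group_transmissions K F' q (c : pulldown K F' q) (U : {set 'I_K}) : nat :=
  (\sum_(S in powerset U | S != finset.set0) \max_(k in S) Vsize c k (S :\ k))%N.

Definition total_normalized (R : realType) K F' q (Kp : nat) (c : pulldown K F' q) : R :=
  (\sum_(U in user_groups K Kp) group_transmissions c U)%:R / (F' * q)%:R.

Definition expected_total (R : realType) K N F' q (g Kp : nat)
  (d : {ffun 'I_K -> 'I_N}) : R :=
  (#|{: placement K N F' q}|%:R)^-1 *
  \sum_(pl : placement K N F' q)
     ((#|[set c : pulldown K F' q | pulldown_valid g Kp d pl c]|%:R)^-1 *
      \sum_(c : pulldown K F' q | pulldown_valid g Kp d pl c)
         total_normalized R Kp c).

(* Main.v *)
Require Import Defs.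
From HB Require Import structures.
From mathcomp Require Import all_boot all_order all_algebra.
From mathcomp Require Import all_classical all_reals.
From mathcomp Require Import all_analysis.
From mathcomp Require Import ring lra zify.
Import Order.TTheory GRing.Theory Num.Theory.
Local Open Scope ring_scope.

(** In a group of n = K' users put F = F' q and a = F / C(n,g). For |T| = g,
    the number |V_{k,T}| of packets pulled down to T is a sum of indicators of
    probability at most 1 / C(n,g) that are independent across packet groups
    and mutually exclusive inside one, since the storing sets of the packets
    of a group are disjoint. Hence mean and variance of |V_{k,T}| are at most
    a, and AM-GM bounds the expected maximum over the g + 1 users of a set by
    7a/6 + 3(g+1)/2; the second term is negligible for F' = 6 g C(n,g).
    Summing over the C(n,g+1) sets gives 7/6 * n/(g+1) plus a small error. A
    packet stored by fewer than g users costs at most one transmission per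
    user; as n >= 3 g q, a Chernoff bound makes this rarer than 2^-g. The
    constant 4/3 absorbs both errors, so no o(1) term is needed. *)

(** * Uniform averages over finite sets and over products of sets *)

Section Averages.
Context {R : realFieldType}.

Definition avg {T : finType} (A : {set T}) (f : T -> R) : R :=
  (#|A|%:R)^-1 * \sum_(x in A) f x.

Lemma eq_avg {T : finType} (A : {set T}) (f g : T -> R) :
  {in A, f =1 g} -> avg A f = avg A g.
Proof. by move=> fg; rewrite /avg; congr (_ * _); apply: eq_bigr. Qed.

Lemma avg_le {T : finType} (A : {set T}) (f g : T -> R) :
  {in A, forall x, f x <= g x} -> avg A f <= avg A g.
Proof.
by move=> fg; rewrite ler_wpM2l ?invr_ge0 ?ler0n//; apply: ler_sum.
Qed.

Lemma avg_sum {T I : finType} (A : {set T}) (P : pred I) (f : I -> T -> R) :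
  avg A (fun x => \sum_(i | P i) f i x) = \sum_(i | P i) avg A (f i).
Proof. by rewrite /avg exchange_big mulr_sumr. Qed.

Lemma avgD {T : finType} (A : {set T}) (f g : T -> R) :
  avg A (fun x => f x + g x) = avg A f + avg A g.
Proof. by rewrite /avg big_split mulrDr. Qed.

Lemma avgZ {T : finType} (A : {set T}) (a : R) (f : T -> R) :
  avg A (fun x => a * f x) = a * avg A f.
Proof. by rewrite /avg -mulr_sumr mulrCA. Qed.

Lemma avg_const {T : finType} (A : {set T}) (a : R) :
  A != finset.set0 -> avg A (fun=> a) = a.
Proof.
rewrite -card_gt0 => A0; rewrite /avg sumr_const -[a *+ _]mulr_natl mulKf//.
by rewrite pnatr_eq0 -lt0n.
Qed.

Lemma avg_indicator {T : finType} (A : {set T}) (P : pred T) :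
  avg A (fun x => (P x)%:R) = #|[set x in A | P x]|%:R / #|A|%:R.
Proof.
rewrite /avg mulrC; congr (_ / _); rewrite -sum1_card natr_sum.
under [RHS]eq_bigl do rewrite inE.
by rewrite big_mkcondr; apply: eq_bigr => x _; case: (P x).
Qed.

(** Models independent choices: the uniform law on this set is the product of the uniform laws on
    the [W i]. *)
Definition prodset {I J : finType} (W : I -> {set J}) : {set {ffun I -> J}} :=
  [set c : {ffun I -> J} | [forall i, c i \in W i]].

Lemma prodsetP {I J : finType} (W : I -> {set J}) (c : {ffun I -> J}) :
  reflect (forall i, c i \in W i) (c \in prodset W).
Proof. by rewrite /prodset inE; apply: forallP. Qed.

Lemma prodset_distr {I J : finType} (W : I -> {set J}) (f : I -> J -> R) :
  \prod_i \sum_(j in W i) f i j = \sum_(c in prodset W) \prod_i f i (c i).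
Proof.
rewrite bigA_distr_big_dep; apply: eq_bigl => c.
by apply/familyP/prodsetP.
Qed.

Lemma card_prodset {I J : finType} (W : I -> {set J}) :
  #|prodset W|%:R = \prod_i #|W i|%:R :> R.
Proof.
under eq_bigr do rewrite -sum1_card natr_sum.
rewrite (prodset_distr W (fun _ _ => 1)) -sum1_card natr_sum.
by apply: eq_bigr => c _; rewrite big1.
Qed.

Lemma prodset_neq0 {I J : finType} (W : I -> {set J}) :
  (forall i, W i != finset.set0) -> prodset W != finset.set0.
Proof.
move=> W0; apply/set0Pn.
have /= W1 i : exists j, j \in W i by apply/set0Pn.
exists [ffun i => xchoose (W1 i)]; apply/prodsetP => i.
by rewrite ffunE; apply: xchooseP.
Qed.

(** Independence in product form: by distributivity both the sum and the cardinality factor over the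
    coordinates. *)
Lemma avg_prod {I J : finType} (W : I -> {set J}) (f : I -> J -> R) :
  avg (prodset W) (fun c => \prod_i f i (c i)) = \prod_i avg (W i) (f i).
Proof. by rewrite /avg big_split/= prodset_distr prodfV card_prodset. Qed.

Lemma avg_coord {I J : finType} (W : I -> {set J}) (i : I) (f : J -> R) :
  (forall i, W i != finset.set0) ->
  avg (prodset W) (fun c => f (c i)) = avg (W i) f.
Proof.
move=> W0.
(* Marginals come from product functions whose other factors are the constant 1, of average 1. *)
have := avg_prod W (fun i' x => if i' == i then f x else 1).
rewrite [in RHS](bigD1 i)//= [X in _ * X]big1 ?mulr1; last first.
  by move=> j /negbTE ji; rewrite ji avg_const.
rewrite eqxx => <-; apply: eq_avg => c _.
by rewrite (bigD1 i)//= eqxx big1 ?mulr1// => j /negbTE ->.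
Qed.

Lemma avg_coord2 {I J : finType} (W : I -> {set J}) (i j : I) (f h : J -> R) :
  (forall i, W i != finset.set0) -> i != j ->
  avg (prodset W) (fun c => f (c i) * h (c j)) = avg (W i) f * avg (W j) h.
Proof.
move=> W0 ij; have ji : j != i by rewrite eq_sym.
have := avg_prod W
  (fun i' x => if i' == i then f x else if i' == j then h x else 1).
rewrite [in RHS](bigD1 i)//= [X in _ = _ * X](bigD1 j)//= [X in _ * (_ * X)]big1.
  rewrite mulr1 eqxx (negbTE ji) eqxx => <-; apply: eq_avg => c _.
  rewrite (bigD1 i)//= (bigD1 j)//= eqxx (negbTE ji) eqxx big1 ?mulr1//.
  by move=> k /andP[/negbTE -> /negbTE ->].
by move=> k /andP[/negbTE ki /negbTE kj]; rewrite ki kj avg_const.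
Qed.

Lemma prod_indicator {I : finType} (P b : pred I) :
  \prod_(i | P i) (b i)%:R = [forall (i | P i), b i]%:R :> R.
Proof.
have [/forallP h|/forallPn[i]] := boolP [forall (i | P i), b i].
  by rewrite big1// => i Pi; move: (h i); rewrite Pi/= => ->.
by rewrite negb_imply => /andP[Pi /negbTE bi]; rewrite (bigD1 i)//= bi mul0r.
Qed.

End Averages.

(** * Binomial sums over the subsets of a finite set *)

Section SubsetSums.
Context {R : realFieldType}.

Lemma sum_subsets {T : finType} (U : {set T}) (f : nat -> R) :
  \sum_(A : {set T} | A \subset U) f #|A|
  = \sum_(s < #|U|.+1) 'C(#|U|, s)%:R * f s.
Proof.
rewrite (partition_big (fun A : {set T} => inord #|A| : 'I_(#|U|.+1)) xpredT)//=.
apply: eq_bigr => s _; rewrite -cards_draws -sum1dep_card natr_sum mulr_suml.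
apply: eq_big => [A|A /andP[AU /eqP <-]].
  case AU: (A \subset U) => //=.
  by rewrite -val_eqE/= inordK// ltnS subset_leq_card.
by rewrite mul1r inordK// ltnS subset_leq_card.
Qed.

Lemma bin_pmf_sum (n : nat) (p : R) :
  \sum_(s < n.+1) 'C(n, s)%:R * (p ^+ s * (1 - p) ^+ (n - s)) = 1.
Proof.
have := exprDn (1 - p) p n; rewrite subrK expr1n => e; rewrite [RHS]e.
by apply: eq_bigr => s _; rewrite -[in RHS]mulr_natl [in RHS](mulrC (_ ^+ _)).
Qed.

(** The probability generating function of the binomial law; [storing_tail] uses it as an
    exponential moment. *)
Lemma bin_pgf (n : nat) (p z : R) :
  \sum_(s < n.+1) 'C(n, s)%:R * (z ^+ s * (p ^+ s * (1 - p) ^+ (n - s)))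
  = (1 - p + z * p) ^+ n.
Proof.
rewrite exprDn; apply: eq_bigr => s _.
by rewrite -[in RHS]mulr_natl exprMn [in RHS](mulrC (_ ^+ (n - s))) !mulrA.
Qed.

(** Both sides count the pairs of disjoint subsets of sizes [g] and [b] in a set of size [n]. *)
Lemma mul_bin_bin (n g b : nat) : (g + b <= n)%N ->
  ('C(n, g) * 'C(n - g, b) = 'C(n, g + b) * 'C(g + b, g))%N.
Proof.
move=> gbn.
have h1 : (g <= n)%N by rewrite (leq_trans _ gbn)// leq_addr.
have h2 : (b <= n - g)%N by rewrite leq_subRL.
have e1 := bin_fact h1; have e2 := bin_fact h2.
have e3 := bin_fact gbn; have e4 := bin_fact (leq_addr b g).
rewrite addKn in e4; rewrite -subnDA in e2.
apply/eqP; rewrite -(eqn_pmul2r (_ : 0 < g`! * b`! * (n - (g + b))`!)%N).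
  apply/eqP; transitivity n`!; first by rewrite -e1 -e2; lia.
  by rewrite -[LHS]e3 -[in LHS]e4; lia.
by rewrite !muln_gt0 !fact_gt0.
Qed.

(* A [#|D|]-subset drawn uniformly from a [p]-random subset of [U] is equally
   likely to be any [#|D|]-subset of [U]; the left-hand side is that chance. *)
Lemma pulled_subset_prob {T : finType} (U D : {set T}) (p : R) :
  0 <= p <= 1 -> D \subset U ->
  \sum_(A : {set T} | A \subset U)
     (D \subset A)%:R / 'C(#|A|, #|D|)%:R
       * (p ^+ #|A| * (1 - p) ^+ (#|U| - #|A|))
  <= ('C(#|U|, #|D|)%:R)^-1.
Proof.
move=> /andP[p0 p1] DU.
set n := #|U|; set g := #|D|.
have gn : (g <= n)%N by rewrite subset_leq_card.
have Cgt0 : 0 < 'C(n, g)%:R :> R by rewrite ltr0n bin_gt0.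
pose f s : R := ('C(g + s, g)%:R)^-1 * (p ^+ (g + s) * (1 - p) ^+ (n - (g + s))).
have -> : \sum_(A : {set T} | A \subset U)
     (D \subset A)%:R / 'C(#|A|, g)%:R * (p ^+ #|A| * (1 - p) ^+ (n - #|A|))
   = \sum_(B : {set T} | B \subset U :\: D) f #|B|.
  rewrite (bigID (fun A : {set T} => D \subset A))/= [X in _ + X]big1 ?addr0; last first.
    by move=> A /andP[_ /negbTE ->]; rewrite !mul0r.
  (* Only supersets of [D] contribute; each is [D :|: B] for a unique [B] disjoint from [D]. *)
  rewrite (reindex_onto (fun B => D :|: B) (fun A => A :\: D))/=; last first.
    move=> A /andP[_ /fintype.subsetP DA]; apply/setP => x; rewrite !inE.
    by have := DA x; case: (x \in D) => //= ->.
  apply: eq_big => [B|B /andP[/andP[_ DB] /eqP BE]].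
    rewrite finset.subUset DU finset.subsetUl andbT finset.subsetD.
    rewrite finset.setDUl finset.setDv finset.set0U finset.eqEsubset finset.subsetDl.
    by rewrite finset.subsetD fintype.subxx.
  have -> : #|D :|: B| = (g + #|B|)%N.
    by rewrite -(cardsID D (D :|: B)) BE (finset.setIidPr DB).
  by rewrite DB mul1r.
rewrite sum_subsets -div1r ler_pdivlMr// mulrC mulr_sumr.
rewrite cardsD (finset.setIidPr DU) -/n -/g.
have nE : (n.+1 = (n - g).+1 + g)%N by rewrite addSn subnK.
rewrite -[leRHS](bin_pmf_sum n p) -[leRHS](big_mkord xpredT
  (fun s => 'C(n, s)%:R * (p ^+ s * (1 - p) ^+ (n - s)))).
(* The binomial probabilities of sizes below [g] are dropped here, which is the only loss in the
   bound. *)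
rewrite (big_cat_nat (n := g))//=; last by rewrite nE leq_addl.
rewrite -[leLHS]add0r lerD//.
  by apply: sumr_ge0 => s _; rewrite mulr_ge0 ?mulr_ge0 ?exprn_ge0 ?subr_ge0.
rewrite -[X in \sum_(X <= _ < _) _]add0n big_addn subSn// big_mkord.
apply: ler_sum => -[b /=]; rewrite ltnS => bn _.
have gbn : (g + b <= n)%N by rewrite -leq_subRL.
(* The factor ['C(g + b, g)] cancels the denominator in [f b] and leaves the binomial probability of
   size [g + b]. *)
rewrite addnC [leLHS]mulrA -natrM mul_bin_bin// natrM /f -mulrA mulVKf//.
by rewrite pnatr_eq0 -lt0n bin_gt0 leq_addr.
Qed.
End SubsetSums.

(** * The law of the storing sets under random placement *)

Section StoringSetLaw.
Context {R : realFieldType} {K N F' q : nat}.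
Variables (n : 'I_N) (U : {set 'I_K}).
Hypothesis q_gt0 : (0 < q)%N.

Let Pl : {set placement K N F' q} := [set: placement K N F' q].

(** The chance that the storing set of a packet meets [U] exactly in [A]: users store the packet
    independently with probability [1 / q]. *)
Definition subset_weight (A : {set 'I_K}) : R :=
  q%:R^-1 ^+ #|A| * (1 - q%:R^-1) ^+ (#|U| - #|A|).

Lemma subset_weightE (A : {set 'I_K}) : A \subset U ->
  subset_weight A
  = \prod_(k in U) (if k \in A then q%:R^-1 else 1 - q%:R^-1).
Proof.
move=> AU; rewrite (bigID (mem A))/=.
rewrite (eq_bigr (fun=> q%:R^-1)); last by move=> k /andP[_ ->].
rewrite [X in _ = _ * X](eq_bigr (fun=> 1 - q%:R^-1)); last first.
  by move=> k /andP[_ /negbTE ->].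
rewrite !prodr_const; congr (_ ^+ _ * _ ^+ _).
  by apply: eq_card => k; rewrite [RHS]unfold_in/=;
     case: (boolP (k \in A)) => [/(fintype.subsetP AU) ->|]; rewrite ?andbF.
rewrite -{1}(finset.setIidPr AU) -cardsD.
by apply: eq_card => k; rewrite [RHS]unfold_in/= !inE andbC.
Qed.

(** Brings a product over the relevant coordinates of a placement into the form over all coordinates
    that [avg_prod] requires. *)
Lemma prod_user_file_group (J : {set 'I_F'}) (G : 'I_K -> 'I_F' -> R) :
  \prod_(x : 'I_K * 'I_N * 'I_F')
     (if [&& x.1.2 == n, x.1.1 \in U & x.2 \in J] then G x.1.1 x.2 else 1)
  = \prod_(j in J) \prod_(k in U) G k j.
Proof.
rewrite pair_big/= -big_mkcond/=.
rewrite (reindex_onto (fun y : 'I_F' * 'I_K => (y.2, n, y.1))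
                      (fun x => (x.2, x.1.1)))/=; last first.
  by move=> [[k n'] j]/= /and3P[/eqP <-].
by apply: eq_bigl => -[j k]/=; rewrite !eqxx andbT/= andbC.
Qed.

Lemma storing_setE (pl : placement K N F' q) (j : 'I_F') (i : 'I_q)
    (A : {set 'I_K}) : A \subset U ->
  (storing_set pl n (j, i) :&: U == A)%:R
  = \prod_(k in U) ((pl (k, n, j) == i) == (k \in A))%:R :> R.
Proof.
move=> AU; rewrite prod_indicator; congr ((_ : bool)%:R).
apply/eqP/forall_inP => [<- k kU|h]; first by rewrite !inE kU andbT.
apply/setP => k; rewrite !inE; have [kU|kU] := boolP (k \in U).
  by rewrite andbT (eqP (h k kU)).
by rewrite andbF; apply/esym/negbTE; apply: contra kU; apply/fintype.subsetP.
Qed.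

Lemma avg_coord_eq (i : 'I_q) (b : bool) :
  avg [set: 'I_q] (fun v => ((v == i) == b)%:R)
  = (if b then q%:R^-1 else 1 - q%:R^-1) :> R.
Proof.
have h : avg [set: 'I_q] (fun v => (v == i)%:R) = q%:R^-1 :> R.
  rewrite avg_indicator cardsT card_ord.
  rewrite (_ : [set x in _ | _] = [set i]) ?cards1 ?mul1r//.
  by apply/setP => x; rewrite !inE.
case: b => /=; first by rewrite -[RHS]h; apply: eq_avg => v _; rewrite eqb_id.
have := @avg_const R _ [set: 'I_q] 1; rewrite -card_gt0 cardsT card_ord => /(_ q_gt0) e.
rewrite -h -[X in _ = X - _]e -[- _]mulN1r -avgZ -avgD; apply: eq_avg => v _.
by case: (v == i); rewrite /= ?mulr1 ?subrr// mulr0 addr0.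
Qed.

(** With one packet per group, the events depend on disjoint sets of placement coordinates, so their
    probabilities multiply. *)
Lemma avg_storing_sets (J : {set 'I_F'}) (i : 'I_F' -> 'I_q)
    (A : 'I_F' -> {set 'I_K}) : (forall j, j \in J -> A j \subset U) ->
  avg Pl (fun pl =>
    \prod_(j in J) (storing_set pl n (j, i j) :&: U == A j)%:R)
  = \prod_(j in J) subset_weight (A j).
Proof.
move=> AU.
rewrite [RHS](eq_bigr _ (fun j jJ => subset_weightE _ (AU j jJ))).
rewrite -(prod_user_file_group J
  (fun k j => if k \in A j then q%:R^-1 else 1 - q%:R^-1)).
pose phi (x : 'I_K * 'I_N * 'I_F') (v : 'I_q) : R :=
  if [&& x.1.2 == n, x.1.1 \in U & x.2 \in J]
  then ((v == i x.2) == (x.1.1 \in A x.2))%:R else 1.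
have -> : Pl = prodset (fun=> [set: 'I_q]).
  by apply/setP => pl; rewrite inE; apply/esym/prodsetP => x; rewrite inE.
transitivity (avg (prodset (fun=> [set: 'I_q]))
    (fun c : {ffun 'I_K * 'I_N * 'I_F' -> 'I_q} => \prod_x phi x (c x))).
  apply: eq_avg => pl _.
  rewrite (eq_bigr (fun j => \prod_(k in U)
      ((pl (k, n, j) == i j) == (k \in A j))%:R)); last first.
    by move=> j jJ; rewrite storing_setE// AU.
  rewrite -(prod_user_file_group J
    (fun k j => ((pl (k, n, j) == i j) == (k \in A j))%:R)).
  apply: eq_bigr => -[[k n'] j] _; rewrite /phi/=.
  by case: ifP => // /andP[/eqP -> _].
rewrite avg_prod; apply: eq_bigr => x _; rewrite /phi.
case: ifP => _; first by rewrite avg_coord_eq.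
by rewrite avg_const// -card_gt0 cardsT card_ord.
Qed.

Definition storing_mean (f : {set 'I_K} -> R) : R :=
  \sum_(A : {set 'I_K} | A \subset U) f A * subset_weight A.

(** Writing [f] as a combination of indicators reduces its expectation to the probabilities in
    [avg_storing_sets]. *)
Lemma expand_storing_set (f : {set 'I_K} -> R) (A : {set 'I_K}) :
  f (A :&: U) = \sum_(B : {set 'I_K} | B \subset U) f B * (A :&: U == B)%:R.
Proof.
rewrite (bigD1 (A :&: U)) ?finset.subsetIr//= eqxx mulr1 big1 ?addr0//.
by move=> B /andP[_ /negbTE]; rewrite eq_sym => ->; rewrite mulr0.
Qed.

Lemma avg_storing_set (f : {set 'I_K} -> R) (p : packet F' q) :
  avg Pl (fun pl => f (storing_set pl n p :&: U)) = storing_mean f.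
Proof.
case: p => j i.
under eq_avg do rewrite expand_storing_set.
rewrite avg_sum; apply: eq_bigr => A AU; rewrite avgZ; congr (_ * _).
have := @avg_storing_sets [set j] (fun=> i) (fun=> A) (fun _ _ => AU).
by rewrite big_set1 => <-; apply: eq_avg => pl _; rewrite big_set1.
Qed.

(** Packets of different groups are independent: expand both functions and take the two groups as
    [J]. *)
Lemma avg_storing_set2 (f h : {set 'I_K} -> R) (p p' : packet F' q) :
  p.1 != p'.1 ->
  avg Pl (fun pl => f (storing_set pl n p :&: U) * h (storing_set pl n p' :&: U))
  = storing_mean f * storing_mean h.
Proof.
case: p p' => [j i] [j' i']/= jj'; have /negbTE j'j : j' != j by rewrite eq_sym.
under eq_avg => pl _.
  rewrite (expand_storing_set f) (expand_storing_set h) mulr_suml; over.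
rewrite avg_sum mulr_suml; apply: eq_bigr => A AU.
under eq_avg => pl _ do rewrite mulr_sumr.
rewrite avg_sum mulr_sumr; apply: eq_bigr => B BU.
under eq_avg => pl _ do rewrite mulrACA.
rewrite avgZ [RHS]mulrACA; congr (_ * _).
have := @avg_storing_sets [set j; j'] (fun x => if x == j then i else i')
  (fun x => if x == j then A else B).
rewrite big_setU1 ?inE//= big_set1 eqxx j'j/= => <-; last by move=> x _; case: ifP.
by apply: eq_avg => pl _; rewrite big_setU1 ?inE//= big_set1 eqxx j'j.
Qed.

End StoringSetLaw.

(** * The pull-down phase: mean and variance of [Vsize] *)

Section Pulldown.
Context {R : realFieldType} {K N F' q : nat}.
Variables (g Kp : nat) (d : {ffun 'I_K -> 'I_N}).
Hypothesis q_gt0 : (0 < q)%N.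

Definition pull_choices (A : {set 'I_K}) : {set {set 'I_K}} :=
  if (g < #|A|)%N then [set B : {set 'I_K} | B \subset A & #|B| == g]
  else [set A].

(** Validity as a product of per-packet choices, so that the conditional law given the placement is
    a [prodset]. *)
Definition pulldowns (pl : placement K N F' q) : {set pulldown K F' q} :=
  prodset (fun x : 'I_K * packet F' q =>
    pull_choices (storing_set pl (d x.1) x.2 :&: user_group Kp x.1)).

Lemma pulldown_validE (pl : placement K N F' q) (c : pulldown K F' q) :
  pulldown_valid g Kp d pl c = (c \in pulldowns pl).
Proof.
apply/forallP/prodsetP => [h [k p]|h k].
  have /forallP/(_ p)/= := h k; rewrite /pull_choices/=.
  by case: ifP => _; rewrite !inE.
apply/forallP => p; have := h (k, p); rewrite /pull_choices/=.
by case: ifP => _; rewrite !inE.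
Qed.

Lemma pull_choices_neq0 (A : {set 'I_K}) : pull_choices A != finset.set0.
Proof.
rewrite /pull_choices; case: ifP => gA; rewrite -card_gt0 ?cards1//.
by rewrite cards_draws bin_gt0 ltnW.
Qed.

(** One formula covers every size: [A] with more than [g] elements is pulled uniformly, [A] with
    exactly [g] is kept and the binomial is 1, and a smaller [A] cannot contain [T]. *)
Lemma pull_prob (A T : {set 'I_K}) : #|T| = g ->
  avg (pull_choices A) (fun B => (B == T)%:R)
  = (T \subset A)%:R / 'C(#|A|, #|T|)%:R :> R.
Proof.
move=> Tg; rewrite avg_indicator Tg /pull_choices; case: ifPn => gA.
  rewrite cards_draws; congr (_%:R / _).
  have [TA|TA] := boolP (T \subset A).
    apply/eqP/cards1P; exists T; apply/setP => B; rewrite !inE.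
    by case: (B =P T) => [->|]; rewrite ?andbF// TA Tg eqxx.
  apply/eqP; rewrite cards_eq0; apply/eqP/setP => B; rewrite !inE.
  by case: (B =P T) => [->|]; rewrite ?andbF// (negbTE TA).
rewrite -leqNgt in gA; rewrite cards1 invr1 mulr1.
have [AT|/eqP AT] := eqVneq A T.
  rewrite AT Tg binn invr1 mulr1 fintype.subxx.
  rewrite (_ : [set x in _ | _] = [set T]) ?cards1//.
  by apply/setP => B; rewrite !inE andbb.
have -> : T \subset A = false.
  apply/negP => TA; apply: AT; apply/esym/eqP.
  by rewrite eqEcard TA Tg.
rewrite mul0r (_ : [set x in _ | _] = finset.set0) ?cards0//.
by apply/setP => B; rewrite !inE; apply/negP => /andP[/eqP -> /eqP].
Qed.

Definition expect (f : pulldown K F' q -> R) : R :=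
  avg [set: placement K N F' q] (fun pl => avg (pulldowns pl) f).

Lemma pulldowns_neq0 (pl : placement K N F' q) : pulldowns pl != finset.set0.
Proof. by apply: prodset_neq0 => x; apply: pull_choices_neq0. Qed.

Lemma expect_le (f h : pulldown K F' q -> R) :
  (forall pl c, pulldown_valid g Kp d pl c -> f c <= h c) ->
  expect f <= expect h.
Proof.
move=> fh; apply: avg_le => pl _; apply: avg_le => c cp.
by apply: (fh pl); rewrite pulldown_validE.
Qed.

Lemma expect_sum {I : finType} (P : pred I) (f : I -> pulldown K F' q -> R) :
  expect (fun c => \sum_(i | P i) f i c) = \sum_(i | P i) expect (f i).
Proof. by rewrite /expect -avg_sum; apply: eq_avg => pl _; rewrite avg_sum. Qed.

Lemma expectD (f h : pulldown K F' q -> R) :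
  expect (fun c => f c + h c) = expect f + expect h.
Proof. by rewrite /expect -avgD; apply: eq_avg => pl _; rewrite avgD. Qed.

Lemma expectZ (a : R) (f : pulldown K F' q -> R) :
  expect (fun c => a * f c) = a * expect f.
Proof. by rewrite /expect -avgZ; apply: eq_avg => pl _; rewrite avgZ. Qed.

Lemma expect_const (a : R) : expect (fun=> a) = a.
Proof.
rewrite /expect -[RHS](@avg_const _ _ [set: placement K N F' q]).
  by apply: eq_avg => pl _; rewrite avg_const// pulldowns_neq0.
by apply/set0Pn; exists [ffun=> Ordinal q_gt0]; rewrite inE.
Qed.

Section User.
Variables (k : 'I_K) (T : {set 'I_K}).
Hypotheses (T_card : #|T| = g) (g_gt0 : (0 < g)%N).
Let U := user_group Kp k.

(** The probability that a given packet of user [k] ends with virtual storing set [T]; it is the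
    same for all packets. *)
Definition pulled_prob : R :=
  storing_mean (q := q) U (fun A => (T \subset A)%:R / 'C(#|A|, #|T|)%:R).

Lemma expect_pulled (p : packet F' q) :
  expect (fun c => (c (k, p) == T)%:R) = pulled_prob.
Proof.
rewrite /pulled_prob -(avg_storing_set (d k) U q_gt0 _ p).
apply: eq_avg => pl _.
rewrite (avg_coord _ (k, p) (fun B => (B == T)%:R)) ?pull_prob// => x.
exact: pull_choices_neq0.
Qed.

(** Given the placement, the pull-downs are independent. Packets of different groups are then fully
    independent. In one group no user stores both packets, so the nonempty [T] cannot lie in both
    storing sets and the average vanishes. *)
Lemma expect_pulled2 (p p' : packet F' q) : p != p' ->
  expect (fun c => (c (k, p) == T)%:R * (c (k, p') == T)%:R)
  <= pulled_prob ^+ 2.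
Proof.
move=> pp'.
have -> : expect (fun c => (c (k, p) == T)%:R * (c (k, p') == T)%:R) =
  avg [set: placement K N F' q] (fun pl =>
    ((T \subset storing_set pl (d k) p :&: U)%:R
      / 'C(#|storing_set pl (d k) p :&: U|, #|T|)%:R)
    * ((T \subset storing_set pl (d k) p' :&: U)%:R
      / 'C(#|storing_set pl (d k) p' :&: U|, #|T|)%:R)).
  apply: eq_avg => pl _.
  rewrite (avg_coord2 _ (k, p) (k, p') (fun B => (B == T)%:R)
    (fun B => (B == T)%:R)) ?pull_prob//.
  + by move=> x; apply: pull_choices_neq0.
  + by apply: contra pp' => /eqP[->].
have [e|ne] := eqVneq p.1 p'.1; last first.
  by rewrite (avg_storing_set2 (d k) U q_gt0
    (fun A => (T \subset A)%:R / 'C(#|A|, #|T|)%:R)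
    (fun A => (T \subset A)%:R / 'C(#|A|, #|T|)%:R) p p' ne) -expr2.
rewrite (le_trans _ (sqr_ge0 _))// -[leRHS](@avg_const _ _ [set: placement K N F' q]).
  apply: avg_le => pl _; rewrite mulrACA -natrM mulnb.
  case: andP => [[/fintype.subsetP TS /fintype.subsetP TS']|_]; last by rewrite mul0r.
  have /card_gt0P[x xT] : (0 < #|T|)%N by rewrite T_card.
  move: (TS x xT) (TS' x xT); rewrite !inE e => /andP[/eqP + _] /andP[/eqP + _].
  move=> -> e2; case/eqP: pp'.
  by rewrite [p]surjective_pairing [p']surjective_pairing e e2.
by apply/set0Pn; exists [ffun=> Ordinal q_gt0]; rewrite inE.
Qed.

Lemma pulled_prob_le : T \subset U -> pulled_prob <= ('C(#|U|, g)%:R)^-1.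
Proof.
move=> TU; rewrite -T_card; apply: pulled_subset_prob => //.
by rewrite invr_ge0 ler0n/= invf_le1 ?ler1n ?ltr0n.
Qed.

Lemma VsizeE (c : pulldown K F' q) :
  (Vsize c k T)%:R = \sum_(p : packet F' q) (c (k, p) == T)%:R :> R.
Proof.
by rewrite /Vsize -sum1dep_card natr_sum big_mkcond; apply: eq_bigr => p _; case: eqP.
Qed.

Lemma expect_Vsize :
  expect (fun c => (Vsize c k T)%:R) = (F' * q)%:R * pulled_prob.
Proof.
transitivity (expect (fun c => \sum_(p : packet F' q) (c (k, p) == T)%:R)).
  by apply: eq_avg => pl _; apply: eq_avg => c _; rewrite VsizeE.
rewrite expect_sum (eq_bigr (fun=> pulled_prob)) => [|p _]; last exact: expect_pulled.
by rewrite sumr_const card_prod !card_ord mulr_natl.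
Qed.

(** The indicators are pairwise nonpositively correlated, so the variance of their sum is at most
    the sum of their variances, hence at most the mean. *)
Lemma variance_Vsize :
  expect (fun c => ((Vsize c k T)%:R - (F' * q)%:R * pulled_prob) ^+ 2)
  <= (F' * q)%:R * pulled_prob.
Proof.
set mu := _ * pulled_prob.
have second : expect (fun c => (Vsize c k T)%:R ^+ 2) <= mu + mu ^+ 2.
  have -> : expect (fun c => (Vsize c k T)%:R ^+ 2) =
      \sum_(p : packet F' q) \sum_(p' : packet F' q)
        expect (fun c => (c (k, p) == T)%:R * (c (k, p') == T)%:R).
    transitivity (expect (fun c => \sum_(p : packet F' q) \sum_(p' : packet F' q)
        (c (k, p) == T)%:R * (c (k, p') == T)%:R)).
      apply: eq_avg => pl _; apply: eq_avg => c _.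
      by rewrite VsizeE expr2 mulr_suml; apply: eq_bigr => p _; rewrite mulr_sumr.
    by rewrite expect_sum; apply: eq_bigr => p _; rewrite expect_sum.
  (* Sets up a comparison row by row: the diagonal pair gives [pulled_prob], every other pair at
     most its square. *)
  have -> : mu + mu ^+ 2 = \sum_(p : packet F' q)
      (pulled_prob + \sum_(p' : packet F' q) pulled_prob ^+ 2).
    rewrite /mu; move: pulled_prob => a.
    rewrite !sumr_const card_prod !card_ord.
    rewrite -(mulr_natl (a + _)) -(mulr_natl (a ^+ 2)).
    by move: (F' * q)%:R => b; ring.
  apply: ler_sum => p _; rewrite (bigD1 p)//= lerD//.
    rewrite -(expect_pulled p); apply: expect_le => pl c _.
    by rewrite -natrM mulnb andbb.
  rewrite [leRHS](bigD1 p)//= -[leLHS]add0r lerD ?sqr_ge0//.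
  by apply: ler_sum => p' pp'; rewrite expect_pulled2// eq_sym.
have -> : expect (fun c => ((Vsize c k T)%:R - mu) ^+ 2) =
    expect (fun c => (Vsize c k T)%:R ^+ 2 + (mu ^+ 2 + - (2 * mu) * (Vsize c k T)%:R)).
  apply: eq_avg => pl _; apply: eq_avg => c _.
  by move: (Vsize c k T)%:R => x; clear second; clearbody mu; ring.
rewrite (expectD (fun c => (Vsize c k T)%:R ^+ 2)).
rewrite (expectD (fun=> mu ^+ 2)) (expectZ (- (2 * mu))) expect_const.
rewrite expect_Vsize -/mu.
move: (expect _) second => x; clearbody mu; nra.
Qed.

End User.

End Pulldown.

(** * Deterministic bounds on the transmissions of a group and on maxima *)

Lemma pull_choicesP {K : nat} (g : nat) (A B : {set 'I_K}) :
  B \in pull_choices g A -> B \subset A /\ #|B| = minn g #|A|.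
Proof.
rewrite /pull_choices; case: ltnP => gA; rewrite inE.
  by move=> /andP[BA /eqP ->].
by move=> /eqP ->.
Qed.

(** Storing sets have at most [g] elements, so sets [S] of size above [g + 1] cost nothing. For
    smaller [S] the maximum is bounded by the sum over users, and each packet is charged to one [S]
    at most. *)
Lemma group_transmissions_le {K F' q g : nat} (c : pulldown K F' q)
    (U : {set 'I_K}) : (forall x, #|c x| <= g)%N ->
  (group_transmissions c U
   <= \sum_(S : {set 'I_K} | (S \subset U) && (#|S| == g.+1))
        \max_(k in S) Vsize c k (S :\ k)
      + \sum_(k in U) \sum_(p : packet F' q) (#|c (k, p)| < g))%N.
Proof.
move=> cg; rewrite /group_transmissions (bigID (fun S : {set 'I_K} => #|S| == g.+1))/=.
apply: leq_add.
  rewrite leq_eqVlt; apply/orP; left; apply/eqP; apply: eq_bigl => S.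
  rewrite powersetE; case: (S \subset U) => //=; apply: andb_idl => /eqP Sg.
  by rewrite -card_gt0 Sg.
apply: (@leq_trans (\sum_(S in powerset U | #|S| != g.+1) \sum_(k in U)
    \sum_(p : packet F' q) ((k \in S) && (c (k, p) == S :\ k)))%N).
  rewrite big_mkcond [leqRHS]big_mkcond; apply: leq_sum => S _.
  rewrite powersetE; have [SU|] := boolP (S \subset U) => //=.
  case: ifP => // /andP[_ ->].
  apply/bigmax_leqP => k kS; rewrite (bigD1 k) ?(fintype.subsetP SU)//= kS/=.
  rewrite /Vsize -sum1dep_card big_mkcond -[leqLHS]addn0 leq_add//.
rewrite exchange_big/=; apply: leq_sum => k _.
rewrite exchange_big/=; apply: leq_sum => p _.
have [cpg|gcp] := ltnP #|c (k, p)| g.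
  (* The only [S] that can be charged is [k] together with the storing set of the packet. *)
  apply: (@leq_trans (\sum_(S : {set 'I_K}) (S == k |: c (k, p)))%N).
    rewrite big_mkcond; apply: leq_sum => S _; case: ifP => // _.
    case: andP => // -[kS /eqP ->].
    by rewrite finset.setD1K// eqxx.
  by rewrite (bigD1 (k |: c (k, p)))//= eqxx big1// => S /negbTE ->.
rewrite leqn0 sum_nat_eq0; apply/forallP => S; apply/implyP => /andP[_ Sg].
rewrite eqb0; apply: contra Sg => /andP[kS /eqP cE].
by rewrite (cardsD1 k) kS -cE add1n eqSS eqn_leq cg gcp.
Qed.

Lemma le_natr_bigmax {R : realFieldType} {I : finType} (A : {set I})
    (F : I -> nat) (x : R) : 0 <= x ->
  {in A, forall i, (F i)%:R <= x} -> (\max_(i in A) F i)%:R <= x.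
Proof.
move=> x0 Fx; elim/big_ind: _ => // a b ax bx.
by rewrite /maxn; case: ifP.
Qed.

(** The squared deviation of any one element is at most their sum. The weight [3 / (2 * a)] is such
    that variances at most [a] add [3 / 2] per element. *)
Lemma bigmax_le_deviation {R : realFieldType} {I : finType} (A : {set I})
    (F : I -> nat) (mu : I -> R) (a : R) : 0 < a ->
  {in A, forall i, mu i <= a} ->
  (\max_(i in A) F i)%:R
  <= 7 / 6 * a + 3 / (2 * a) * \sum_(i in A) ((F i)%:R - mu i) ^+ 2.
Proof.
move=> a0 mua.
have c0 : 0 <= 3 / (2 * a) by rewrite divr_ge0// mulr_ge0// ltW.
apply: le_natr_bigmax => [|i iA].
  have /(mulr_ge0 c0) : 0 <= \sum_(i in A) ((F i)%:R - mu i) ^+ 2.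
    by apply: sumr_ge0 => i _; rewrite sqr_ge0.
  lra.
have : ((F i)%:R - mu i) ^+ 2 <= \sum_(i in A) ((F i)%:R - mu i) ^+ 2.
  by rewrite (bigD1 i iA)/= lerDl sumr_ge0// => j _; rewrite sqr_ge0.
move=> /(ler_wpM2l c0) h.
(* AM-GM: [y <= t + y ^+ 2 / (4 * t)] with [t = a / 6] *)
have amgm (y : R) : y <= a / 6 + 3 / (2 * a) * y ^+ 2.
  rewrite -subr_ge0 (_ : _ - _ = 3 / (2 * a) * (y - a / 3) ^+ 2).
    by rewrite mulr_ge0 ?sqr_ge0.
  by field; rewrite gt_eqF.
have := amgm ((F i)%:R - mu i); have := mua i iA; lra.
Qed.

(** * A Chernoff bound for packets stored by few users *)

Lemma expR2_ge6 {R : realType} : 6 <= expR (2 : R).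
Proof.
(* Uses [expR (1 / 8) >= 9 / 8], raised to the power 16. *)
have -> : (2 : R) = 16%:R * 8^-1 by field.
rewrite expRM_natl; apply: (@le_trans _ _ ((9 / 8) ^+ 16)); first by lra.
by apply: lerXn2r; rewrite ?nnegrE ?expR_ge0//; apply: le_trans (expR_ge1Dx _); lra.
Qed.

(** Chernoff at [z = 1 / 3]: the indicator is at most [3 ^+ g / 3 ^+ #|A|], whose mean is at most
    [3 ^+ g * expR (-2) ^+ g], and [expR 2 >= 6]. *)
Lemma storing_tail {R : realType} {K : nat} (q g : nat) (U : {set 'I_K}) :
  (0 < q)%N -> (3 * g * q <= #|U|)%N ->
  storing_mean (q := q) U (fun A => (#|A| < g)%:R) <= (2^-1 : R) ^+ g.
Proof.
move=> q0 gU; set p : R := q%:R^-1.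
have p0 : 0 < p by rewrite invr_gt0 ltr0n.
have p1 : p <= 1 by rewrite invf_le1 ?ler1n ?ltr0n.
apply: (@le_trans _ _ (3 ^+ g * \sum_(A : {set 'I_K} | A \subset U)
    (3^-1 ^+ #|A| * (p ^+ #|A| * (1 - p) ^+ (#|U| - #|A|))))).
  rewrite mulr_sumr; apply: ler_sum => A _; rewrite mulrA ler_wpM2r//.
    by rewrite mulr_ge0 ?exprn_ge0 ?subr_ge0 ?(ltW p0).
  rewrite exprVn; have [Ag|gA] := ltnP.
    by rewrite ler_pdivlMr ?exprn_gt0// mul1r ler_weXn2l ?ler1n// ltnW.
  by rewrite divr_ge0 ?exprn_ge0.
rewrite (sum_subsets U (fun s => 3^-1 ^+ s * (p ^+ s * (1 - p) ^+ (#|U| - s)))).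
rewrite bin_pgf.
have e2 : 1 - p + 3^-1 * p <= expR (- (2 / 3 * p)).
  by apply: le_trans (expR_ge1Dx _); lra.
have e3 : (1 - p + 3^-1 * p) ^+ #|U| <= 6^-1 ^+ g.
  apply: (@le_trans _ _ (expR (- (2 / 3 * p)) ^+ #|U|)).
    by apply: lerXn2r e2; rewrite ?nnegrE ?expR_ge0//; lra.
  apply: (@le_trans _ _ (expR (-2) ^+ g)).
    (* The mean number of storing users, [p * #|U|], is at least [3 * g], so the exponent
       [2 / 3 * p * #|U|] is at least [2 * g]. *)
    rewrite -!expRM_natl ler_expR !mulrN lerN2.
    have : (3 * g * q)%:R <= #|U|%:R :> R by rewrite ler_nat.
    rewrite !natrM -ler_pdivlMr ?ltr0n// -/p; lra.
  apply: lerXn2r; rewrite ?nnegrE ?expR_ge0// expRN lef_pV2 ?posrE ?expR_gt0//.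
  exact: expR2_ge6.
apply: (@le_trans _ _ (3 ^+ g * 6^-1 ^+ g)); first by rewrite ler_wpM2l// exprn_ge0.
rewrite -exprMn (_ : 3 * 6^-1 = 2^-1 :> R)//; by field.
Qed.

(** * The expected total as an iterated average; size and number of the user groups *)

Lemma expected_totalE {R : realType} {K N F' q : nat} (g Kp : nat)
    (d : {ffun 'I_K -> 'I_N}) :
  expected_total R F' q g Kp d = expect g Kp d (@total_normalized R K F' q Kp).
Proof.
rewrite /expected_total /expect /avg cardsT; congr (_ * _).
apply: eq_big => [pl|pl _]; first by rewrite inE.
have e : [set c | pulldown_valid g Kp d pl c] = pulldowns g Kp d pl.
  by apply/setP => c; rewrite inE pulldown_validE.
by rewrite e; congr (_ * _); apply: eq_bigl => c; rewrite pulldown_validE.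
Qed.

Lemma user_group_eq {K : nat} (Kp : nat) (k k' : 'I_K) :
  k' \in user_group Kp k -> user_group Kp k' = user_group Kp k.
Proof.
by rewrite inE => /eqP e; apply/setP => k''; rewrite !inE e.
Qed.

(** As [Kp] divides the number of users, no group is truncated: adding [i] to the start of the block
    is a bijection from ['I_Kp]. *)
Lemma card_user_group {m Kp : nat} (k : 'I_(m * Kp)) :
  #|user_group Kp k| = Kp.
Proof.
have Kp0 : (0 < Kp)%N by case: Kp k => [|//] k; have := ltn_ord k; rewrite {2}muln0.
have tm : (k %/ Kp < m)%N by rewrite ltn_divLR.
have lt (i : 'I_Kp) : (k %/ Kp * Kp + i < m * Kp)%N.
  by have := ltn_ord i; nia.
rewrite -[RHS]card_ord -(card_imset _ (_ : injective (fun i => Ordinal (lt i)))).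
  apply: eq_card => x; rewrite inE; apply/eqP/imsetP => [e|[i _ ->]/=].
    have xi : (x %% Kp < Kp)%N by rewrite ltn_mod.
    exists (Ordinal xi) => //; apply: val_inj => /=.
    by rewrite -e -divn_eq.
  by rewrite divnMDl// (divn_small (ltn_ord i)) addn0.
by move=> i j [] /eqP; rewrite eqn_add2l => /eqP; apply: val_inj.
Qed.

Lemma card_user_groups (m Kp : nat) : (0 < Kp)%N ->
  (#|user_groups (m * Kp) Kp| <= m)%N.
Proof.
move=> Kp0; rewrite -[leqRHS]card_ord -cardsT.
apply: leq_trans (leq_imset_card (fun t : 'I_m =>
  [set k' : 'I_(m * Kp) | k' %/ Kp == t]%N) _).
apply: subset_leq_card; apply/fintype.subsetP => U /imsetP[k _ ->].
have tm : (k %/ Kp < m)%N by rewrite ltn_divLR.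
by apply/imsetP; exists (Ordinal tm).
Qed.

(** * Expected transmissions of one group *)

Section GroupBound.
Context {R : realType} {K N F' q : nat}.
Variables (g Kp : nat) (d : {ffun 'I_K -> 'I_N}) (k0 : 'I_K).
Hypothesis q_gt0 : (0 < q)%N.
Hypothesis g_gt0 : (0 < g)%N.
Hypothesis F'_gt0 : (0 < F')%N.
Let U := user_group Kp k0.
Let F : R := (F' * q)%:R.
Let a : R := F / 'C(#|U|, g)%:R.

Lemma expect_max_Vsize (S : {set 'I_K}) : (g <= #|U|)%N ->
  S \subset U -> #|S| = g.+1 ->
  expect g Kp d (fun c : pulldown K F' q =>
    (\max_(k in S) Vsize c k (S :\ k))%:R) <= 7 / 6 * a + 3 / 2 * g.+1%:R :> R.
Proof.
move=> gU SU Sg.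
have F0 : 0 < F by rewrite ltr0n muln_gt0 F'_gt0.
have a0 : 0 < a by rewrite divr_gt0// ltr0n bin_gt0.
have Ug k : k \in S -> user_group Kp k = U.
  by move=> /(fintype.subsetP SU)/user_group_eq.
have Tg k : k \in S -> #|S :\ k| = g.
  by move=> kS; have := cardsD1 k S; rewrite kS Sg add1n => -[].
pose mu k : R := F * pulled_prob (q := q) Kp k (S :\ k).
have mua : {in S, forall k, mu k <= a}.
  move=> k kS; rewrite ler_wpM2l ?(ltW F0)//.
  have := @pulled_prob_le R K q g Kp q_gt0 k (S :\ k) (Tg k kS).
  rewrite Ug//; apply.
  by apply: fintype.subset_trans SU; rewrite finset.subD1set.
apply: (@le_trans _ _ (expect g Kp d (fun c : pulldown K F' q =>
    7 / 6 * a + 3 / (2 * a) * \sum_(k in S) ((Vsize c k (S :\ k))%:R - mu k) ^+ 2))).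
  by apply: expect_le => pl c _; apply: bigmax_le_deviation.
rewrite (expectD _ _ _ (fun=> 7 / 6 * a)) expect_const//.
rewrite (expectZ _ _ _ (3 / (2 * a))) expect_sum lerD2l.
(* The error is read as [g + 1] variances, each at most [a]. *)
have -> : 3 / 2 * g.+1%:R = 3 / (2 * a) * \sum_(k in S) a.
  rewrite sumr_const Sg -(mulr_natl a) [in RHS]mulrCA.
  by move: g.+1%:R => x; field; rewrite gt_eqF.
rewrite ler_wpM2l ?divr_ge0 ?mulr_ge0 ?(ltW a0)//.
apply: ler_sum => k kS; apply: le_trans (mua k kS).
by apply: variance_Vsize => //; rewrite Tg.
Qed.

(** The sets of size [g + 1] are handled by [expect_max_Vsize]; each of the [#|U| * F] pairs of user
    and packet is then charged its Chernoff tail. *)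
Lemma expect_group_transmissions : (3 * g * q <= #|U|)%N ->
  expect g Kp d (fun c : pulldown K F' q => (group_transmissions c U)%:R)
  <= 'C(#|U|, g.+1)%:R * (7 / 6 * a + 3 / 2 * g.+1%:R)
     + #|U|%:R * F * (2^-1) ^+ g :> R.
Proof.
move=> gqU; have gU : (g <= #|U|)%N by apply: leq_trans gqU; nia.
apply: (@le_trans _ _ (expect g Kp d (fun c : pulldown K F' q =>
  \sum_(S : {set 'I_K} | (S \subset U) && (#|S| == g.+1))
        (\max_(k in S) Vsize c k (S :\ k))%:R
      + \sum_(k in U) \sum_(p : packet F' q) (#|c (k, p)| < g)%:R))).
  apply: expect_le => pl c; rewrite pulldown_validE => /prodsetP cpl.
  have cg x : (#|c x| <= g)%N.
    by have [_ ->] := pull_choicesP _ _ _ (cpl x); rewrite geq_minl.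
  rewrite -natr_sum; under [X in _ <= _ + X]eq_bigr do rewrite -natr_sum.
  by rewrite -natr_sum -natrD ler_nat; apply: group_transmissions_le.
rewrite (expectD _ _ _ (fun c => \sum_(S : {set 'I_K} | _) _)) !expect_sum.
apply: lerD.
  rewrite -cards_draws -sum1dep_card natr_sum mulr_suml.
  by apply: ler_sum => S /andP[SU /eqP Sg]; rewrite mul1r expect_max_Vsize.
rewrite -mulrA mulr_natl -sumr_const; apply: ler_sum => k kU.
rewrite expect_sum /F mulr_natl.
rewrite -[in leRHS](card_ord F') -[in leRHS](card_ord q) -card_prod -sumr_const.
apply: ler_sum => p _.
have Ue : user_group Kp k = U by apply: user_group_eq.
apply: le_trans (storing_tail q g U q_gt0 gqU).
rewrite -(avg_storing_set (d k) U q_gt0 _ p); apply: avg_le => pl _.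
rewrite -[leRHS](avg_const _ _ (pulldowns_neq0 g Kp d pl)).
(* Pull-down leaves [minn g] of the original size, so a virtual set is smaller than [g] exactly when
   the original one is. *)
apply: avg_le => c /prodsetP/(_ (k, p))/pull_choicesP[_ ->] /=.
by rewrite Ue gtn_min ltnn.
Qed.

End GroupBound.

(** * Numerical estimates and the sum over the groups *)

Lemma ceil_nat_ge {R : realType} (x : R) : x <= (ceil_nat x)%:R.
Proof.
apply: le_trans (ceil_ge x) _.
by rewrite /ceil_nat natr_absz ler_int ler_norm.
Qed.

(** Induction on [g]: the step multiplies the binomial by [n / g], a ratio of at least [b]. *)
Lemma exp_le_bin (b g n : nat) : (b * g <= n)%N -> (b ^ g <= 'C(n, g))%N.
Proof.
elim: g n => [|g IH] n bn; first by rewrite bin0.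
case: b => [|b] in IH bn *; first by rewrite exp0n.
case: n => [|n] in bn *; first by lia.
have h : (b.+1 ^ g <= 'C(n, g))%N by apply: IH; nia.
rewrite -(leq_pmul2l (ltn0Sn g)) -mul_bin_diag/= expnS.
by apply: leq_trans (leq_mul bn h); rewrite [in leqRHS]mulnAC mulnC.
Qed.

Lemma exp2_ge (g : nat) : (7 <= g)%N -> (16 * g.+1 <= 2 ^ g)%N.
Proof.
elim: g => // g IH; rewrite leq_eqVlt => /orP[/eqP <-//|/IH h].
by rewrite expnS; lia.
Qed.

(** Relative to [n * F / (g + 1)] the three terms are at most [7 / 6], [2 / 21] and [1 / 16], with
    sum [445 / 336], just below [4 / 3 = 448 / 336]. *)
Lemma group_budget {R : realFieldType} (n g q F' : nat) :
  (7 <= g)%N -> (3 <= q)%N -> (g <= n)%N -> F' = (6 * g * 'C(n, g))%N ->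
  'C(n, g.+1)%:R * (7 / 6 * ((F' * q)%:R / 'C(n, g)%:R) + 3 / 2 * g.+1%:R)
     + n%:R * (F' * q)%:R * (2^-1) ^+ g
  <= (F' * q)%:R * (4 / 3 * (n%:R / g.+1%:R)) :> R.
Proof.
move=> g7 q3 gn F'E.
have C0 : 0 < 'C(n, g)%:R :> R by rewrite ltr0n bin_gt0.
have g0 : 0 < g.+1%:R :> R by rewrite ltr0n.
have C1 : 'C(n, g.+1)%:R * g.+1%:R <= n%:R * 'C(n, g)%:R :> R.
  by rewrite -!natrM ler_nat mulnC mul_bin_left leq_mul2r leq_subr orbT.
have e2 : (2^-1) ^+ g <= (16 * g.+1%:R)^-1 :> R.
  rewrite exprVn lef_pV2 ?posrE ?exprn_gt0// ?mulr_gt0//.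
  by rewrite -[2]/(2%:R) -[16]/(16%:R) -natrX -natrM ler_nat exp2_ge.
have g7R : 7 <= g%:R :> R by rewrite ler_nat.
have q3R : 3 <= q%:R :> R by rewrite ler_nat.
have n0 : 0 <= n%:R :> R by [].
have FE : (F' * q)%:R = 6 * g%:R * q%:R * 'C(n, g)%:R :> R.
  by rewrite F'E !natrM; ring.
have gE : g.+1%:R = g%:R + 1 :> R by rewrite natr1.
move: FE C0 C1 e2 g7R q3R n0 g0; rewrite gE.
move: ('C(n, g)%:R : R) ('C(n, g.+1)%:R : R) (g%:R : R) (q%:R : R) (n%:R : R).
move: ((F' * q)%:R : R) ((2^-1) ^+ g : R) => F e C C' x y m FE C0 C1 e2 x7 y3 m0 x0.
have F0 : 0 < F by rewrite FE !mulr_gt0//; lra.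
rewrite -(ler_pM2r x0).
have t1 : C' * (7 / 6 * (F / C)) * (x + 1) <= 7 / 6 * (m * F).
  have -> : C' * (7 / 6 * (F / C)) * (x + 1) =
      (C' * (x + 1)) * (7 / 6 * F / C) by field; rewrite gt_eqF.
  have -> : 7 / 6 * (m * F) = (m * C) * (7 / 6 * F / C) by field; rewrite gt_eqF.
  by rewrite ler_wpM2r// divr_ge0 ?(ltW C0)// mulr_ge0 ?(ltW F0)//; lra.
(* From [g >= 7] and [q >= 3], [3 / 2 * (g + 1)] is at most [4 / 7 * g * q]; the factor 6 in [F']
   turns [4 / 7] into [2 / 21]. *)
have t2 : C' * (3 / 2 * (x + 1)) * (x + 1) <= 2 / 21 * (m * F).
  have h : C' * (x + 1) * (3 / 2 * (x + 1)) <= m * C * (3 / 2 * (x + 1)).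
    by rewrite ler_wpM2r//; lra.
  have h2 : m * C * (3 / 2 * (x + 1)) <= m * C * (4 / 7 * (x * y)).
    by rewrite ler_wpM2l ?mulr_ge0 ?(ltW C0)//; nra.
  rewrite FE; lra.
have t3 : m * F * e * (x + 1) <= 1 / 16 * (m * F).
  have mF : 0 <= m * F by rewrite mulr_ge0 ?(ltW F0).
  have -> : 1 / 16 * (m * F) = m * F * ((16 * (x + 1))^-1 * (x + 1)).
    by field; rewrite gt_eqF.
  by rewrite -mulrA ler_wpM2l// ler_wpM2r// ltW.
have -> : F * (4 / 3 * (m / (x + 1))) * (x + 1) = 4 / 3 * (m * F).
  by field; rewrite gt_eqF.
have mF : 0 <= m * F by rewrite mulr_ge0 ?(ltW F0).
lra.
Qed.

Lemma expected_total_le {R : realType} {N : nat} (m g Kp q F' : nat)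
    (d : {ffun 'I_(m * Kp) -> 'I_N}) :
  (7 <= g)%N -> (3 <= q)%N -> (3 * g * q <= Kp)%N ->
  F' = (6 * g * 'C(Kp, g))%N ->
  expected_total R F' q g Kp d <= 4 / 3 * ((m * Kp)%:R / g.+1%:R).
Proof.
move=> g7 q3 gq F'E.
have g0 : (0 < g)%N by apply: leq_trans g7.
have q0 : (0 < q)%N by apply: leq_trans q3.
have gK : (g <= Kp)%N by apply: leq_trans gq; nia.
have Kp0 : (0 < Kp)%N by apply: leq_trans gK.
have F'0 : (0 < F')%N by rewrite F'E !muln_gt0 g0 bin_gt0.
have F0 : 0 < (F' * q)%:R :> R by rewrite ltr0n muln_gt0 F'0.
rewrite expected_totalE.
have -> : expect g Kp d (@total_normalized R _ F' q Kp) =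
  expect g Kp d (fun c : pulldown (m * Kp) F' q => (F' * q)%:R^-1 *
    \sum_(U in user_groups (m * Kp) Kp) (group_transmissions c U)%:R) :> R.
  apply: eq_avg => pl _; apply: eq_avg => c _.
  by rewrite /total_normalized mulrC natr_sum.
rewrite expectZ expect_sum mulrC ler_pdivrMr//.
apply: (@le_trans _ _ (\sum_(U in user_groups (m * Kp) Kp)
    ((F' * q)%:R * (4 / 3 * (Kp%:R / g.+1%:R))))).
  apply: ler_sum => U /imsetP[k _ ->].
  have := @expect_group_transmissions R _ N F' q g Kp d k q0 g0 F'0.
  rewrite card_user_group => /(_ gq)/le_trans; apply.
  exact: group_budget.
rewrite sumr_const -[leLHS]mulr_natr (natrM _ m Kp).
have := card_user_groups m Kp Kp0; rewrite -(ler_nat R).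
move: (#|_|%:R : R) => u um.
have -> : 4 / 3 * (m%:R * Kp%:R / g.+1%:R) * (F' * q)%:R
  = (F' * q)%:R * (4 / 3 * (Kp%:R / g.+1%:R)) * m%:R :> R by ring.
by rewrite ler_wpM2l// !mulr_ge0// invr_ge0.
Qed.

(** * Bounds on e and the choice of parameters *)

Lemma expR1_gt2 {R : realType} : 2 < expR (1 : R).
Proof.
rewrite [X in expR X](_ : 1 = 2%:R * 2^-1); last by field.
rewrite expRM_natl expr2; have := expR_ge1Dx (2^-1 : R); nra.
Qed.

Lemma expR1_le {R : realType} : expR (1 : R) <= 256 / 81.
Proof.
(* From [expR (- 1 / 4) >= 3 / 4], e is at most [(4 / 3) ^+ 4]. *)
rewrite [X in expR X](_ : 1 = - (4%:R * - 4^-1)); last by field.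
rewrite expRN expRM_natl.
have h : 3 / 4 <= expR (- 4^-1 : R) by apply: le_trans (expR_ge1Dx _); lra.
have -> : 256 / 81 = ((3 / 4) ^+ 4)^-1 :> R by field.
rewrite lef_pV2 ?posrE ?exprn_gt0 ?expR_gt0//.
by apply: lerXn2r; rewrite ?nnegrE ?expR_ge0//; lra.
Qed.

(** A bootstrap: [r > 2] gives [ln r >= 1 / 2], so the gain condition forces [r ^+ 2 >= 21 / 2],
    which exceeds the square of [256 / 81] and hence of e. *)
Lemma ln_ge1_of_gain {R : realType} (r : R) (g : nat) : 2 < r -> (7 <= g)%N ->
  g%:R <= r ^+ 2 / (3 * ln r) -> 1 <= ln r.
Proof.
move=> r2 g7 gr; have g7R : 7 <= g%:R :> R by rewrite ler_nat.
have r0 : 0 < r by lra.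
have half : 2^-1 <= ln r.
  rewrite -[leLHS]expRK ler_ln ?posrE ?expR_gt0//; apply: le_trans (ltW r2).
  rewrite -lef_pV2 ?posrE ?expR_gt0// -expRN.
  by apply: le_trans (expR_ge1Dx _); lra.
have h : 21 * ln r <= r ^+ 2.
  have := le_trans g7R gr; rewrite ler_pdivlMr; lra.
rewrite -[leLHS]expRK ler_ln ?posrE ?expR_gt0// leNgt; apply/negP => re.
have := @expR1_le R; nra.
Qed.

Theorem theorem8 (R : realType) :
  exists (C : R) (eps : nat -> R),
    (forall e : R, 0 < e -> exists n0 : nat, forall n : nat, (n0 <= n)%N -> `|eps n| <= e) /\
    forall (N : nat) (M : R) (g : nat),
      0 < M -> M <= N%:R ->
      let r := N%:R / M in
      let q := ceil_nat r in
      expR (1 : R) <= q%:R ->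
      (7 <= g)%N ->
      g%:R <= r ^+ 2 / (3 * ln r) ->
      let Kp := ceil_nat (q%:R * 3 * g%:R * ln r) in
      (Kp < N)%N ->
      exists F' : nat,
        (0 < F')%N /\
        F'%:R <= C * ('C(Kp, g))%:R * (ln (('C(Kp, g))%:R : R)) ^+ 2 /\
        forall m : nat, (0 < m)%N ->
        forall d : {ffun 'I_(m * Kp) -> 'I_N},
          expected_total R F' q g Kp d
            <= 4 / 3 * ((m * Kp)%:R / (g.+1)%:R) * (1 + eps Kp).
Proof.
(* The bound holds with zero error term; 6 is the constant of [F'] below. *)
exists 6, (fun=> 0); split; first by move=> e e0; exists 0%N => n _; rewrite normr0 ltW.
move=> N M g M0 MN r q eq g7 gr Kp _.
have q3 : (3 <= q)%N by rewrite -(ltr_nat R); apply: lt_le_trans eq; exact: expR1_gt2.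
have r0 : 0 <= r by rewrite divr_ge0 ?(ltW M0).
have r2 : 2 < r.
  have : 2 <= Num.ceil r - 1.
    (* Nonnegativity makes the absolute value in [ceil_nat] harmless, so the ceiling itself is at
       least 3. *)
    have c0 : 0 <= Num.ceil r by rewrite ceil_ge0; lra.
    by move: q3; rewrite /q /ceil_nat; lia.
  by rewrite -(ler_int R) => /le_lt_trans; apply; exact: ceilB1_lt.
have lnr := ln_ge1_of_gain r g r2 g7 gr.
(* Here [ln r >= 1] is used: it makes the group large enough for the Chernoff bound. *)
have gq : (3 * g * q <= Kp)%N.
  rewrite -(ler_nat R) !natrM; apply: le_trans (ceil_nat_ge _).
  rewrite -[leLHS]mulr1 (_ : 3 * g%:R * q%:R = q%:R * 3 * g%:R); last by ring.
  by rewrite ler_wpM2l// !mulr_ge0.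
have gK : (g <= Kp)%N by apply: leq_trans gq; nia.
exists (6 * g * 'C(Kp, g))%N; split; first by rewrite !muln_gt0 bin_gt0 gK; lia.
split; last by move=> m _ d; rewrite addr0 mulr1; apply: expected_total_le.
rewrite !natrM [leLHS]mulrAC ler_wpM2l ?mulr_ge0//.
(* As [Kp >= 9 * g], the binomial is at least [4 ^ g], hence at least [expR g]; thus the factor [g]
   in [F'] fits under the squared logarithm. *)
have lnC : g%:R <= ln ('C(Kp, g)%:R : R).
  rewrite -[leLHS]expRK ler_ln ?posrE ?expR_gt0 ?ltr0n ?bin_gt0//.
  rewrite -[g%:R]mulr1 expRM_natl; apply: (@le_trans _ _ (4 ^+ g)).
    by apply: lerXn2r; rewrite ?nnegrE ?expR_ge0//; have := @expR1_le R; lra.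
  by rewrite -[4]/(4%:R) -natrX ler_nat exp_le_bin//; nia.
apply: (@le_trans _ _ (g%:R ^+ 2)).
  by rewrite -natrX ler_nat; nia.
by apply: lerXn2r; rewrite ?nnegrE//; apply: le_trans lnC.
Qed.
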